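(* For $K>2$ let $L^*(K)$ be the bifurcation line, defined implicitly as the solution $L=L^*(K)<0$ with $K+L>2$ of $$\sqrt{1-\frac{2K}{K^2-L^2}}=V\left((K+L)\sqrt{1-\frac{2K}{K^2-L^2}}\right).$$ Then for all $K>2$: 1. $\frac{\partial L^*(K)}{\partial K}<0$. 2. $\frac{\partial^2L^*(K)}{\partial K^2}<0$.
   Context: $V:\mathbb{R}\to\mathbb{R}$ is defined by $$V(x)=\frac{\int_0^{2\pi}\cos\theta\,e^{x\cos\theta}\,d\theta}{\int_0^{2\pi}e^{x\cos\theta}\,d\theta}.$$ The bifurcation line is the set of parameters $(K,L)$, $L<0$, at which solutions with $r_1\ne r_2$ of the equations $r_1=V(Kr_1+Lr_2)$, $r_2=V(Kr_2+Lr_1)$ branch off from the symmetric solution $r_1=r_2=r^*>0$. On this line $r^*=\sqrt{1-\frac{2K}{K^2-L^2}}$, and a symmetric solution with $r^*>0$ exists only if $K+L>2$. *)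

(* Defs.v *)
From Stdlib Require Import Reals.
From Coquelicot Require Import Coquelicot.
Open Scope R_scope.

Definition V (x : R) : R :=
  RInt (fun theta => cos theta * exp (x * cos theta)) 0 (2 * PI) /
  RInt (fun theta => exp (x * cos theta)) 0 (2 * PI).

(* The symmetric value [r1 = r2 = rstar K L] on the bifurcation line.
   [sqrt] is [0] on negative reals, but for [0 < K], [L < 0] and [K + L > 2]
   one has [K - L > K], hence [K ^ 2 - L ^ 2 > 2 * K]: the denominator is
   nonzero and the radicand is positive. *)
Definition rstar (K L : R) : R := sqrt (1 - 2 * K / (K ^ 2 - L ^ 2)).

Definition on_bifurcation_line (K L : R) : Prop :=
  L < 0 /\ K + L > 2 /\ rstar K L = V ((K + L) * rstar K L).

(* Main.v *)
(* Write [V u = u / mu u]. In the coordinates [s = K + L], [d = K - L],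
   [u = s * rstar], the Riccati equation [V' = 1 - V / u - V ^ 2] turns the
   defining equation of the bifurcation line into the parametrization
   [s = u / V u], [d = 1 / V' u] ([u > 0]). With [D = s ^ 2 - s - u ^ 2] one has
   [d = s ^ 2 / D], and [(s, D)] solves the autonomous system
     [u s' = s - D],  [u D' = s + 3 D - 2 s D],
   leaving the equilibrium [(2, 2)] at [u = 0]. Now [dL/dK < 0] means
   [s' / d' < 1], and [d^2 L/dK^2 < 0] means that [s' / d'] decreases; both are
   polynomial inequalities in [(s, D)], implied by
   [s / (2 s - 3) < D < upper s] for an explicit rational function [upper]. The
   two bounds are barriers for the planar system. *)
Require Import Defs.
From Stdlib Require Import Reals Lra Psatz Ranalysis5.
From Coquelicot Require Import Coquelicot.
Open Scope R_scope.

(** * Weighted Bessel integrals: derivatives, recurrences and positivity *)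

(** The weight [g] is left general because differentiating in [x] only multiplies it by [cos t]: the
    family is closed under differentiation. *)
Definition bessel_integral (g : R -> R) (x : R) : R :=
  RInt (fun t => g t * exp (x * cos t)) 0 (2 * PI).

Lemma continuous_bessel_integrand (g : R -> R) (x t : R) :
  (forall t, continuous g t) -> continuous (fun t => g t * exp (x * cos t)) t.
Proof.
  intros Hg. apply (continuous_mult g); [apply Hg |].
  apply (ex_derive_continuous (fun t => exp (x * cos t))). auto_derive. exact I.
Qed.

Lemma ex_RInt_bessel_integrand (g : R -> R) (x : R) :
  (forall t, continuous g t) ->
  ex_RInt (fun t => g t * exp (x * cos t)) 0 (2 * PI).
Proof.
  intros Hg. apply (ex_RInt_continuous (V := R_CompleteNormedModule)).
  intros t _. now apply continuous_bessel_integrand.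
Qed.

Lemma is_derive_bessel_integral (g : R -> R) (x : R) :
  (forall t, continuous g t) ->
  is_derive (bessel_integral g) x (bessel_integral (fun t => g t * cos t) x).
Proof.
  intros Hg.
  assert (Hd : forall z t,
    is_derive (fun z => g t * exp (z * cos t)) z (g t * cos t * exp (z * cos t))).
  { intros z t. auto_derive; [exact I | ring]. }
  unfold bessel_integral.
  rewrite <- (RInt_ext (fun t => Derive (fun z => g t * exp (z * cos t)) x)).
  2:{ intros t _. apply is_derive_unique, Hd. }
  apply is_derive_RInt_param with (f := fun z t => g t * exp (z * cos t)).
  - apply filter_forall. intros z t _. eexists. apply Hd.
  - intros t _.
    apply continuity_2d_pt_ext with (f := fun u v => g v * cos v * exp (u * cos v)).
    { intros u v. symmetry. apply is_derive_unique, Hd. }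
    assert (Hc : continuity_2d_pt (fun _ v => cos v) x t).
    { apply (continuity_1d_2d_pt_comp cos (fun _ v => v)).
      - apply continuity_cos.
      - apply continuity_2d_pt_id2. }
    repeat apply continuity_2d_pt_mult.
    + apply (continuity_1d_2d_pt_comp g (fun _ v => v)).
      * apply continuity_pt_filterlim, Hg.
      * apply continuity_2d_pt_id2.
    + exact Hc.
    + apply (continuity_1d_2d_pt_comp exp (fun u v => u * cos v)).
      * apply derivable_continuous_pt, derivable_pt_exp.
      * apply continuity_2d_pt_mult; [apply continuity_2d_pt_id1 | exact Hc].
  - apply filter_forall. intros z. now apply ex_RInt_bessel_integrand.
Qed.

Ltac ring_R := match goal with |- @eq _ ?a ?b => change (@eq R a b) end; ring.

Ltac cont :=
  match goal with |- continuous ?f ?t => apply (ex_derive_continuous f); auto_derive; auto end.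

(** Up to the factor [2 * PI], [I0] and [I1] are the modified Bessel functions of orders 0 and 1.
    The other names are not Bessel functions of that index: [I2] is the second derivative of [I0],
    [J0] is [I1 x / x] extended smoothly to [x = 0], and [J1] is the derivative of [J0]. *)
Definition I0 : R -> R := bessel_integral (fun _ => 1).
Definition I1 : R -> R := bessel_integral cos.
Definition I2 : R -> R := bessel_integral (fun t => cos t * cos t).
Definition J0 : R -> R := bessel_integral (fun t => sin t * sin t).
Definition J1 : R -> R := bessel_integral (fun t => sin t * sin t * cos t).

Lemma is_derive_I0 (x : R) : is_derive I0 x (I1 x).
Proof.
  replace (I1 x) with (bessel_integral (fun t => 1 * cos t) x).
  - apply is_derive_bessel_integral. intros t. apply continuous_const.
  - apply RInt_ext. intros. ring_R.
Qed.

Lemma is_derive_I1 (x : R) : is_derive I1 x (I2 x).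
Proof. apply is_derive_bessel_integral. intros t. cont. Qed.

Lemma is_derive_J0 (x : R) : is_derive J0 x (J1 x).
Proof. apply (is_derive_bessel_integral (fun t => sin t * sin t)). intros t. cont. Qed.

(** Integration by parts: the derivative of [sin t * exp (x * cos t)] integrates to zero over a
    period. *)
Lemma I1_eq (x : R) : I1 x = x * J0 x.
Proof.
  assert (H : is_RInt (fun t => minus (cos t * exp (x * cos t))
        (scal x (sin t * sin t * exp (x * cos t)))) 0 (2 * PI)
        (minus (sin (2 * PI) * exp (x * cos (2 * PI))) (sin 0 * exp (x * cos 0)))).
  { apply (is_RInt_derive (fun t => sin t * exp (x * cos t))).
    - intros t _. auto_derive; [exact I |].
      unfold minus, plus, opp, scal; simpl; unfold mult; simpl. ring.
    - intros t _. unfold minus, plus, opp, scal; simpl; unfold mult; simpl. cont. }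
  apply (is_RInt_unique (V := R_CompleteNormedModule)) in H.
  rewrite (RInt_minus (V := R_CompleteNormedModule)) in H.
  - rewrite (RInt_scal (V := R_CompleteNormedModule)) in H.
    + rewrite sin_2PI, sin_0 in H. unfold I1, J0, bessel_integral.
      unfold minus, plus, opp, scal in H; simpl in H; unfold mult in H; simpl in H. lra.
    + apply (ex_RInt_bessel_integrand (fun t => sin t * sin t)). intros t. cont.
  - apply ex_RInt_bessel_integrand. intros t. cont.
  - apply (ex_RInt_scal (V := R_NormedModule)),
      (ex_RInt_bessel_integrand (fun t => sin t * sin t)). intros t. cont.
Qed.

Lemma I2_eq (x : R) : I2 x = I0 x - J0 x.
Proof.
  unfold I2, I0, J0, bessel_integral.
  rewrite <- (RInt_minus (V := R_CompleteNormedModule)).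
  - apply RInt_ext. intros t _. unfold minus, plus, opp; simpl.
    pose proof (sin2_cos2 t) as H. unfold Rsqr in H.
    replace (cos t * cos t) with (1 - sin t * sin t) by lra. ring_R.
  - apply (ex_RInt_bessel_integrand (fun _ => 1)). intros t. cont.
  - apply (ex_RInt_bessel_integrand (fun t => sin t * sin t)). intros t. cont.
Qed.

(** Differentiating [I1 x = x * J0 x] gives [I2 x = J0 x + x * J1 x], which is compared with
    [I2 x = I0 x - J0 x]. *)
Lemma J1_eq (x : R) : x * J1 x = I0 x - 2 * J0 x.
Proof.
  assert (H : is_derive I1 x (J0 x + x * J1 x)).
  { apply is_derive_ext with (fun z => z * J0 z).
    - intros z. symmetry. apply I1_eq.
    - evar_last; [apply (is_derive_mult (fun z => z) J0);
        [apply @is_derive_id | apply is_derive_J0 | apply Rmult_comm] |].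
      unfold plus, mult, one; simpl. ring. }
  pose proof (is_derive_unique _ _ _ H) as E1.
  rewrite (is_derive_unique _ _ _ (is_derive_I1 x)), I2_eq in E1. lra.
Qed.

Lemma I0_0 : I0 0 = 2 * PI.
Proof.
  unfold I0, bessel_integral. rewrite (RInt_ext _ (fun _ => 1)).
  - rewrite RInt_const. unfold scal; simpl; unfold mult; simpl. ring.
  - intros. rewrite Rmult_0_l, exp_0. ring_R.
Qed.

Lemma J0_0 : J0 0 = PI.
Proof.
  pose proof (J1_eq 0) as H. rewrite I0_0 in H. lra.
Qed.

Lemma exp_le_compat (x y : R) : x <= y -> exp x <= exp y.
Proof.
  intros [H | ->]; [left; now apply exp_increasing | apply Rle_refl].
Qed.

(** The integrand vanishes at [t = PI], inside the interval, so positivity comes from comparison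
    with [exp (- Rabs x) * J0 0], where [J0 0 = PI]. *)
Lemma J0_pos (x : R) : 0 < J0 x.
Proof.
  assert (H : scal (exp (- Rabs x)) (J0 0) <= J0 x).
  { unfold J0 at 1, bessel_integral. rewrite <- (RInt_scal (V := R_CompleteNormedModule)).
    - apply RInt_le.
      + pose proof PI_RGT_0. lra.
      + apply (ex_RInt_scal (V := R_NormedModule)),
          (ex_RInt_bessel_integrand (fun t => sin t * sin t)). intros t. cont.
      + apply (ex_RInt_bessel_integrand (fun t => sin t * sin t)). intros t. cont.
      + intros t _. unfold scal; simpl; unfold mult; simpl.
        rewrite Rmult_0_l, exp_0, Rmult_1_r, Rmult_comm.
        apply Rmult_le_compat_l; [nra |].
        apply exp_le_compat.
        assert (Rabs (x * cos t) <= Rabs x).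
        { rewrite Rabs_mult. rewrite <- (Rmult_1_r (Rabs x)) at 2.
          apply Rmult_le_compat_l; [apply Rabs_pos |].
          apply Rabs_le. apply COS_bound. }
        pose proof (Rle_abs (- (x * cos t))) as H1. rewrite Rabs_Ropp in H1. lra.
    - apply (ex_RInt_bessel_integrand (fun t => sin t * sin t)). intros t. cont. }
  rewrite J0_0 in H. unfold scal in H; simpl in H; unfold mult in H; simpl in H.
  pose proof (exp_pos (- Rabs x)). pose proof PI_RGT_0. nra.
Qed.

Lemma I0_pos (x : R) : 0 < I0 x.
Proof.
  apply RInt_gt_0.
  - pose proof PI_RGT_0. lra.
  - intros t _. rewrite Rmult_1_l. apply exp_pos.
  - intros t _. apply (continuous_bessel_integrand (fun _ => 1)). intros. apply continuous_const.
Qed.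

(** * The planar system satisfied by [mu] and [delta] *)

(* [mu u = u / V u] for [u <> 0], but smooth and equal to [2] at [u = 0]. *)
Definition mu (u : R) : R := I0 u / J0 u.

(** By the Riccati equation this is [mu u ^ 2] times the derivative of [V] at [u]. *)
Definition delta (u : R) : R := mu u ^ 2 - mu u - u ^ 2.

Lemma V_eq (u : R) : V u = u / mu u.
Proof.
  assert (E : V u = I1 u / I0 u).
  { unfold V, I1, I0, bessel_integral. f_equal.
    apply RInt_ext. intros. ring_R. }
  rewrite E, I1_eq. unfold mu.
  pose proof (I0_pos u). pose proof (J0_pos u). field. lra.
Qed.

Lemma mu_pos (u : R) : 0 < mu u.
Proof. apply Rdiv_lt_0_compat; [apply I0_pos | apply J0_pos]. Qed.

Lemma mu_0 : mu 0 = 2.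
Proof. unfold mu. rewrite I0_0, J0_0. field. apply PI_neq0. Qed.

Lemma delta_0 : delta 0 = 2.
Proof. unfold delta. rewrite mu_0. ring. Qed.

Lemma continuous_mu (u : R) : continuous mu u.
Proof.
  apply (ex_derive_continuous mu). eexists.
  apply is_derive_div; [apply is_derive_I0 | apply is_derive_J0 |].
  pose proof (J0_pos u). lra.
Qed.

Lemma is_derive_mu (u : R) : 0 < u ->
  is_derive mu u ((mu u - delta u) / u).
Proof.
  intros Hu. pose proof (J0_pos u) as HJ.
  evar_last.
  - apply is_derive_div; [apply is_derive_I0 | apply is_derive_J0 | lra].
  - unfold delta, mu. rewrite I1_eq.
    replace (J1 u) with ((I0 u - 2 * J0 u) / u).
    + field. lra.
    + rewrite <- J1_eq. field. lra.
Qed.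

Lemma is_derive_delta (u : R) : 0 < u ->
  is_derive delta u ((mu u + 3 * delta u - 2 * mu u * delta u) / u).
Proof.
  intros Hu. unfold delta at 1.
  evar_last.
  - apply (is_derive_minus (fun u => mu u ^ 2 - mu u) (fun u => u ^ 2)).
    + apply (is_derive_minus (fun u => mu u ^ 2) mu).
      * apply is_derive_pow, is_derive_mu, Hu.
      * apply is_derive_mu, Hu.
    + apply is_derive_pow, is_derive_id.
  - unfold minus, plus, opp, one; simpl. unfold delta. field. lra.
Qed.

Lemma continuous_delta (u : R) : continuous delta u.
Proof.
  unfold delta. pose proof (continuous_mu u) as Hs.
  apply (continuous_minus (fun u => mu u ^ 2 - mu u) (fun u => u ^ 2)).
  - apply (continuous_minus (fun u => mu u ^ 2) mu); [| exact Hs].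
    apply (continuous_comp mu (fun s => s ^ 2)); [exact Hs | cont].
  - cont.
Qed.

(** * Comparison principle and barriers for the planar system *)

(** If [f u <= 0], then [f] has a nonpositive minimum over [[0, u]] at a point other than 0, and a
    positive derivative there yields smaller values just to the left. Derivatives are taken only at
    positive points because the system is singular at 0, where all barriers start with equality. *)
Lemma positive_of_increasing_where_nonpositive (f df : R -> R) :
  f 0 = 0 -> (forall u, 0 <= u -> continuous f u) ->
  (forall u, 0 < u -> is_derive f u (df u)) ->
  (forall u, 0 < u -> f u <= 0 -> 0 < df u) ->
  forall u, 0 < u -> 0 < f u.
Proof.
  intros H0 Hc Hd Hpos u Hu.
  (* A point of [(0, u]] where [f] is nonpositive cannot minimize [f] on [[0, u]]. *)
  assert (Hmin : forall m, 0 < m <= u -> f m <= 0 ->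
                 exists v, 0 <= v <= u /\ f v < f m).
  { intros m Hm Hfm. pose proof (Hpos m (proj1 Hm) Hfm) as Hp.
    pose proof (Hd m (proj1 Hm)) as [_ Hl].
    (* Tolerance half the derivative: difference quotients near [m] stay positive. *)
    specialize (Hl m (fun P H => H) (mkposreal _ (Rdiv_lt_0_compat _ 2 Hp ltac:(lra)))).
    destruct Hl as [e He].
    pose (h := Rmin (e / 2) (m / 2)).
    assert (Hh : 0 < h /\ h < e /\ h <= m / 2).
    { pose proof (cond_pos e). unfold h, Rmin. destruct Rle_dec; lra. }
    exists (m - h). split; [lra |].
    assert (Hb : ball m e (m - h)).
    { unfold ball; simpl; unfold AbsRing_ball, abs, minus, plus, opp; simpl.
      replace (m - h + - m) with (- h) by ring. rewrite Rabs_Ropp, Rabs_pos_eq; lra. }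
    specialize (He _ Hb). simpl in He.
    unfold norm, minus, plus, opp, scal in He; simpl in He.
    unfold abs, mult in He; simpl in He.
    replace (m - h + - m) with (- h) in He by ring.
    rewrite (Rabs_Ropp h), (Rabs_pos_eq h) in He by lra.
    apply Rabs_le_between in He. nra. }
  destruct (continuity_ab_min f 0 u) as [m [Hm Hmu]]; [lra | |].
  { intros c Hcu. apply continuity_pt_filterlim, Hc, Hcu. }
  apply Rnot_le_lt. intros Hfu.
  (* If the minimizer is 0, then [0 = f 0 <= f u <= 0], so [u] is a minimizer as well. *)
  assert (exists n, 0 < n <= u /\ f n <= 0 /\ forall c, 0 <= c <= u -> f n <= f c)
    as [n [Hn [Hfn Hnmin]]].
  { destruct (Req_dec m 0) as [-> | Hm0].
    - exists u. repeat split; try lra. intros c Hcu. specialize (Hm c Hcu). lra.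
    - exists m. repeat split; try lra; [| apply Hm].
      apply Rle_trans with (f u); [apply Hm |]; lra. }
  destruct (Hmin n Hn Hfn) as [v [Hv Hlt]]. specialize (Hnmin v Hv). lra.
Qed.

(** Where [mu u <= 2], one has [mu u - delta u = mu u * (2 - mu u) + u ^ 2 > 0], so [mu] increases
    there. *)
Lemma mu_gt_2 (u : R) : 0 < u -> 2 < mu u.
Proof.
  intros Hu.
  enough (0 < mu u - 2) by lra.
  apply (positive_of_increasing_where_nonpositive (fun u => mu u - 2)
           (fun u => (mu u - delta u) / u)); [| | | | exact Hu].
  - rewrite mu_0. ring.
  - intros v _. apply (continuous_minus mu (fun _ => 2)).
    + apply continuous_mu.
    + apply continuous_const.
  - intros v Hv. evar_last.
    + apply (is_derive_minus mu (fun _ => 2)).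
      * apply is_derive_mu, Hv.
      * apply is_derive_const.
    + unfold minus, plus, opp, zero; simpl. ring.
  - intros v Hv Hs. apply Rdiv_lt_0_compat; [| exact Hv].
    pose proof (mu_pos v). unfold delta. nra.
Qed.

Lemma continuous_barrier (phi : R -> R) (u : R) :
  continuous phi (mu u) -> continuous (fun u => phi (mu u) - delta u) u.
Proof.
  intros Hphi. apply (continuous_minus (fun u => phi (mu u)) delta).
  - apply (continuous_comp mu phi); [apply continuous_mu | exact Hphi].
  - apply continuous_delta.
Qed.

Lemma is_derive_barrier (phi : R -> R) (dphi u : R) :
  0 < u -> is_derive phi (mu u) dphi ->
  is_derive (fun u => phi (mu u) - delta u) u
    ((dphi * (mu u - delta u)
      - (mu u + 3 * delta u - 2 * mu u * delta u)) / u).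
Proof.
  intros Hu Hphi. evar_last.
  - apply (is_derive_minus (fun u => phi (mu u)) delta).
    + apply (is_derive_comp phi mu); [exact Hphi | apply is_derive_mu, Hu].
    + apply is_derive_delta, Hu.
  - unfold minus, plus, opp, scal; simpl; unfold mult; simpl. field. lra.
Qed.

Lemma mu_ge_2 (u : R) : 0 <= u -> 2 <= mu u.
Proof.
  intros [Hu | <-]; [left; now apply mu_gt_2 | rewrite mu_0; lra].
Qed.

(* The nullcline of [delta] is a lower barrier. *)
Lemma delta_lower_bound (u : R) : 0 < u -> mu u / (2 * mu u - 3) < delta u.
Proof.
  intros Hu.
  pose (phi := fun s => s / (2 * s - 3)).
  enough (0 < - (phi (mu u) - delta u)) by (unfold phi in *; lra).
  apply (positive_of_increasing_where_nonpositive
    (fun u => - (phi (mu u) - delta u))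
    (fun u => - ((- 3 / (2 * mu u - 3) ^ 2 * (mu u - delta u)
      - (mu u + 3 * delta u - 2 * mu u * delta u)) / u)));
    [| | | | exact Hu].
  - unfold phi. rewrite mu_0, delta_0. field.
  - intros v Hv. apply (continuous_opp (fun u => phi (mu u) - delta u)).
    apply continuous_barrier. pose proof (mu_ge_2 v Hv). unfold phi.
    apply (ex_derive_continuous (fun s => s / (2 * s - 3))). auto_derive. lra.
  - intros v Hv. apply (is_derive_opp (fun u => phi (mu u) - delta u)).
    apply is_derive_barrier; [exact Hv |].
    pose proof (mu_gt_2 v Hv). unfold phi. auto_derive; [lra |].
    field. lra.
  - intros v Hv. cbv beta. unfold phi.
    pose proof (mu_gt_2 v Hv) as Hs.
    generalize dependent (mu v); intros s Hs. generalize (delta v); intros D HD.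
    (* On or below the nullcline, [delta] does not decrease and [mu] increases; since [phi] is
       decreasing, [delta] gains on the barrier. *)
    assert (Hq : D * (2 * s - 3) <= s).
    { apply (Rmult_le_reg_r (/ (2 * s - 3))).
      - apply Rinv_0_lt_compat. lra.
      - rewrite Rmult_assoc, Rinv_r by lra. unfold Rdiv in HD. lra. }
    assert (HDs : D < s) by nra.
    assert (0 < 3 / (2 * s - 3) ^ 2 * (s - D)).
    { apply Rmult_lt_0_compat; [| lra]. apply Rdiv_lt_0_compat; [lra |].
      apply pow_lt. lra. }
    replace (- ((- 3 / (2 * s - 3) ^ 2 * (s - D) - (s + 3 * D - 2 * s * D)) / v))
      with ((3 / (2 * s - 3) ^ 2 * (s - D) + (s + 3 * D - 2 * s * D)) / v)
      by (field; lra).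
    apply Rdiv_lt_0_compat; lra.
Qed.

(* [upper] agrees to first order with the solution curve at [s = 2] and to order
   [1 / s] at infinity; it lies between that curve and the first zero of
   [curvature_poly s]. *)
Definition upper_num (x : R) : R := 12 * x ^ 3 + 34 * x ^ 2 + 63 * x + 162.

Definition upper_den (x : R) : R := 24 * x ^ 3 + 32 * x ^ 2 + 72 * x + 81.

Ltac positivity :=
  repeat first [ assumption | lra
    | apply Rplus_lt_0_compat | apply Rmult_lt_0_compat | apply pow_lt ].

Lemma upper_num_pos (x : R) : 0 <= x -> 0 < upper_num x.
Proof. intros Hx. unfold upper_num. pose proof (pow_le x 2 Hx). pose proof (pow_le x 3 Hx). lra. Qed.

Lemma upper_den_pos (x : R) : 0 <= x -> 0 < upper_den x.
Proof. intros Hx. unfold upper_den. pose proof (pow_le x 2 Hx). pose proof (pow_le x 3 Hx). lra. Qed.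

Definition dupper (s : R) : R :=
  ((36 * (s - 2) ^ 2 + 68 * (s - 2) + 63) * upper_den (s - 2)
   - upper_num (s - 2) * (72 * (s - 2) ^ 2 + 64 * (s - 2) + 72)) / upper_den (s - 2) ^ 2.

Definition upper (s : R) : R := upper_num (s - 2) / upper_den (s - 2).

Lemma is_derive_upper (s : R) : 2 <= s -> is_derive upper s (dupper s).
Proof.
  intros Hs. pose proof (upper_den_pos (s - 2) ltac:(lra)) as Hd.
  unfold upper, dupper, upper_num, upper_den in *. auto_derive.
  - lra.
  - field. lra.
Qed.

(** On the graph of [upper] the vector field points strictly below the graph. *)
Lemma upper_is_barrier (s : R) : 2 < s ->
  0 < dupper s * (s - upper s) - (s + 3 * upper s - 2 * s * upper s).
Proof.
  intros Hs. pose (x := s - 2). assert (Hx : 0 < x) by (unfold x; lra).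
  pose proof (upper_den_pos x ltac:(lra)) as Hd.
  replace (dupper s * (s - upper s) - (s + 3 * upper s - 2 * s * upper s))
    (* The factor [x ^ 2] reflects the first-order contact at [s = 2]. The single negative
       coefficient is absorbed by its neighbours: the quadratic part has negative discriminant. *)
    with (x ^ 2 * (590490 - 329508 * x + 79056 * x ^ 2 + 45360 * x ^ 3 + 24576 * x ^ 4
            + 69696 * x ^ 5 + 3456 * x ^ 6) / upper_den x ^ 3).
  - apply Rdiv_lt_0_compat; [| apply pow_lt, Hd].
    apply Rmult_lt_0_compat; [apply pow_lt, Hx |].
    pose proof (pow_lt x 3 Hx). pose proof (pow_lt x 4 Hx).
    pose proof (pow_lt x 5 Hx). pose proof (pow_lt x 6 Hx). nra.
  - replace s with (x + 2) by (unfold x; ring).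
    unfold upper, dupper. replace (x + 2 - 2) with x by ring.
    unfold upper_den, upper_num in *. field. lra.
Qed.

Lemma dupper_neg (s : R) : 2 <= s -> dupper s < 0.
Proof.
  intros Hs. pose (x := s - 2). assert (Hx : 0 <= x) by (unfold x; lra).
  pose proof (upper_den_pos x Hx) as Hd.
  replace (dupper s) with
    (- ((6561 + 4860 * x + 8316 * x ^ 2 + 1296 * x ^ 3 + 432 * x ^ 4) / upper_den x ^ 2)).
  - apply Ropp_lt_gt_0_contravar, Rdiv_lt_0_compat; [| apply pow_lt, Hd].
    pose proof (pow_le x 2 Hx). pose proof (pow_le x 3 Hx). pose proof (pow_le x 4 Hx). lra.
  - unfold dupper. fold x. unfold upper_num, upper_den in *. field. lra.
Qed.

Lemma upper_lt_2 (s : R) : 2 < s -> upper s < 2.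
Proof.
  intros Hs. pose (x := s - 2). assert (Hx : 0 < x) by (unfold x; lra).
  pose proof (upper_den_pos x ltac:(lra)) as Hd.
  unfold upper. fold x. apply (Rmult_lt_reg_r (upper_den x)); [exact Hd |].
  unfold Rdiv. rewrite Rmult_assoc, Rinv_l by lra.
  unfold upper_num, upper_den. pose proof (pow_lt x 2 Hx). pose proof (pow_lt x 3 Hx). lra.
Qed.

(** The sign is required above the barrier as well as on it. The derivative of the gap is affine in
    [delta], with slope [2 * s - 3 - dupper s] up to the factor [1 / u]; this is positive because
    [dupper s < 0], so the value on the barrier is the worst case. *)
Lemma delta_upper_bound (u : R) : 0 < u -> delta u < upper (mu u).
Proof.
  intros Hu. enough (0 < upper (mu u) - delta u) by lra.
  apply (positive_of_increasing_where_nonpositive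
    (fun u => upper (mu u) - delta u)
    (fun u => (dupper (mu u) * (mu u - delta u)
      - (mu u + 3 * delta u - 2 * mu u * delta u)) / u));
    [| | | | exact Hu].
  - rewrite mu_0, delta_0. unfold upper, upper_num, upper_den. field.
  - intros v Hv. apply continuous_barrier. apply (ex_derive_continuous upper).
    eexists. apply is_derive_upper, mu_ge_2, Hv.
  - intros v Hv. apply is_derive_barrier; [exact Hv |].
    apply is_derive_upper. left. apply mu_gt_2, Hv.
  - intros v Hv HD. apply Rdiv_lt_0_compat; [| exact Hv].
    pose proof (mu_gt_2 v Hv) as Hs. pose proof (upper_is_barrier (mu v) Hs).
    pose proof (dupper_neg (mu v) ltac:(lra)). nra.
Qed.

Lemma delta_bounds (u : R) : 0 < u -> 1 / 2 < delta u < 2.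
Proof.
  intros Hu. pose proof (mu_gt_2 u Hu) as Hs. split.
  - apply Rlt_trans with (mu u / (2 * mu u - 3)); [| now apply delta_lower_bound].
    apply (Rmult_lt_reg_r (2 * mu u - 3)); [lra |].
    unfold Rdiv. rewrite (Rmult_assoc (mu u)), Rinv_l by lra. lra.
  - eapply Rlt_trans; [apply delta_upper_bound, Hu | apply upper_lt_2, Hs].
Qed.

(** * Polynomial inequalities behind the two derivative signs *)

(** Expansion of [diff_speed s D - sum_speed s D]. *)
Definition slope_poly (s D : R) : R :=
  D ^ 3 - 3 * s * D ^ 2 + 2 * s ^ 3 * D - s ^ 2 * D - s ^ 3.

Lemma slope_poly_pos (s D : R) :
  2 < s -> s / (2 * s - 3) < D < 2 -> 0 < slope_poly s D.
Proof.
  (* In the variables [x, y > 0] all coefficients are positive. *)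
  intros Hs [HD1 HD2]. pose (x := s - 2). pose (y := (2 - D) / (D - s / (2 * s - 3))).
  assert (Hx : 0 < x) by (unfold x; lra).
  assert (Hy : 0 < y) by (apply Rdiv_lt_0_compat; lra).
  assert (Es : s = x + 2) by (unfold x; ring).
  (* [D] is the mean of 2 and the lower barrier with weights 1 and [y], so [y > 0] covers the whole
     open interval. *)
  assert (ED : D = (2 + (x + 2) / (2 * x + 1) * y) / (1 + y)).
  { assert (Eq : (x + 2) / (2 * x + 1) = s / (2 * s - 3)) by (rewrite Es; f_equal; ring).
    rewrite Eq. assert (Ey : y * (D - s / (2 * s - 3)) = 2 - D) by (unfold y, Rdiv at 1; rewrite Rmult_assoc, Rinv_l by lra; ring).
    apply (Rmult_eq_reg_r (1 + y)); [| lra].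
    unfold Rdiv at 1. rewrite Rmult_assoc, Rinv_l by lra. lra. }
  clearbody x y. subst s D. clear HD1 HD2.
  replace (slope_poly _ _) with (
    ((16 * x + 112 * x ^ 2 + 291 * x ^ 3 + 338 * x ^ 4 + 164 * x ^ 5 + 24 * x ^ 6)
     + (48 * x + 312 * x ^ 2 + 744 * x ^ 3 + 780 * x ^ 4 + 336 * x ^ 5 + 48 * x ^ 6) * y
     + (48 * x + 288 * x ^ 2 + 588 * x ^ 3 + 492 * x ^ 4 + 180 * x ^ 5 + 24 * x ^ 6) * y ^ 2
     + (16 * x + 88 * x ^ 2 + 108 * x ^ 3 + 50 * x ^ 4 + 8 * x ^ 5) * y ^ 3)
    / ((2 * x + 1) * (1 + y)) ^ 3).
  - apply Rdiv_lt_0_compat; positivity.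
  - unfold slope_poly. field. lra.
Qed.

(** Numerator of the derivative of [slope] along the system, after removal of the positive factor
    [4 * D]. *)
Definition curvature_poly (s D : R) : R :=
  D ^ 5 - 5 * s ^ 2 * D ^ 4 + 3 * s * D ^ 4 + 4 * s ^ 4 * D ^ 3 - 3 * s ^ 3 * D ^ 3
  + 4 * s ^ 2 * D ^ 3 - 2 * s ^ 5 * D ^ 2 - 3 * s ^ 4 * D ^ 2 + 2 * s ^ 3 * D ^ 2
  + 3 * s ^ 5 * D - s ^ 4 * D - s ^ 5.

Lemma curvature_poly_neg (s D : R) :
  2 < s -> 0 < D < upper s -> curvature_poly s D < 0.
Proof.
  (* In the variables [x, y > 0] all coefficients are negative. *)
  intros Hs [HD1 HD2]. pose (x := s - 2). pose (y := upper s / D - 1).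
  assert (Hx : 0 < x) by (unfold x; lra).
  pose proof (upper_den_pos x ltac:(lra)) as Hd.
  assert (Hy : 0 < y).
  { unfold y. apply (Rmult_lt_reg_r D); [exact HD1 |].
    replace ((upper s / D - 1) * D) with (upper s - D) by (field; lra). lra. }
  assert (Es : s = x + 2) by (unfold x; ring).
  (* Here [D = upper s / (1 + y)], and [y > 0] covers all of [0 < D < upper s]. *)
  assert (ED : D = upper_num x / (upper_den x * (1 + y))).
  { unfold y, upper. fold x. pose proof (upper_num_pos x ltac:(lra)). field. lra. }
  clearbody x y. subst s D. clear HD1 HD2.
  enough (0 < - curvature_poly (x + 2) (upper_num x / (upper_den x * (1 + y)))
      * (upper_den x * (1 + y)) ^ 5) as H.
  { assert (0 < (upper_den x * (1 + y)) ^ 5) by (apply pow_lt, Rmult_lt_0_compat; lra). nra. }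
  replace (- curvature_poly (x + 2) (upper_num x / (upper_den x * (1 + y)))
      * (upper_den x * (1 + y)) ^ 5) with
    (let s := x + 2 in let D := upper_num x in let q := upper_den x * (1 + y) in
    (* Homogenization to degree 5 in [D] and [q], which now stand for the numerator and denominator
       of the original [D]. *)
    - (D ^ 5 - 5 * s ^ 2 * D ^ 4 * q + 3 * s * D ^ 4 * q + 4 * s ^ 4 * D ^ 3 * q ^ 2
    - 3 * s ^ 3 * D ^ 3 * q ^ 2
  + 4 * s ^ 2 * D ^ 3 * q ^ 2 - 2 * s ^ 5 * D ^ 2 * q ^ 3 - 3 * s ^ 4 * D ^ 2 * q ^ 3
  + 2 * s ^ 3 * D ^ 2 * q ^ 3
  + 3 * s ^ 5 * D * q ^ 4 - s ^ 4 * D * q ^ 4 - s ^ 5 * q ^ 5)).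
  - cbv zeta. unfold upper_num, upper_den.
    match goal with |- 0 < ?e => ring_simplify e end.
    positivity.
  - cbv zeta. unfold curvature_poly. field. lra.
Qed.

(** * The parametrized curve, its slope and its range *)

Definition Kpar (u : R) : R := (mu u + mu u ^ 2 / delta u) / 2.

Definition Lpar (u : R) : R := (mu u - mu u ^ 2 / delta u) / 2.

(* Along the curve, [u * delta ^ 2 * (K + L)' = sum_speed] and
   [u * delta ^ 2 * (K - L)' = diff_speed]. *)
Definition sum_speed (s D : R) : R := (s - D) * D ^ 2.

Definition diff_speed (s D : R) : R := s * (2 * s ^ 2 * D - s ^ 2 - s * D - 2 * D ^ 2).

Definition slope (s D : R) : R :=
  (sum_speed s D - diff_speed s D) / (sum_speed s D + diff_speed s D).

(** Consequently [Kpar] increases and [Lpar] decreases. The first inequality comes from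
    [delta u < 2 < mu u], the second from [slope_poly_pos]. *)
Lemma speed_bounds (u : R) : 0 < u ->
  0 < sum_speed (mu u) (delta u) < diff_speed (mu u) (delta u).
Proof.
  intros Hu. pose proof (mu_gt_2 u Hu) as Hs. pose proof (delta_bounds u Hu) as HD.
  split.
  - apply Rmult_lt_0_compat; [lra | apply pow_lt; lra].
  - pose proof (slope_poly_pos (mu u) (delta u) Hs
      (conj (delta_lower_bound u Hu) (proj2 HD))) as H.
    unfold slope_poly in H. unfold sum_speed, diff_speed. nra.
Qed.

Definition dKpar (u : R) : R :=
  (sum_speed (mu u) (delta u) + diff_speed (mu u) (delta u)) / (2 * u * delta u ^ 2).

Lemma dKpar_pos (u : R) : 0 < u -> 0 < dKpar u.
Proof.
  intros Hu. pose proof (speed_bounds u Hu). pose proof (delta_bounds u Hu).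
  apply Rdiv_lt_0_compat; [lra |].
  apply Rmult_lt_0_compat; [lra | apply pow_lt; lra].
Qed.

Lemma is_derive_Kpar (u : R) : 0 < u ->
  is_derive Kpar u (dKpar u).
Proof.
  intros Hu. pose proof (delta_bounds u Hu) as HD. unfold Kpar.
  pose proof (is_derive_mu u Hu) as H1. pose proof (is_derive_delta u Hu) as H2.
  auto_derive.
  - repeat split; try lra; eexists; eassumption.
  - rewrite (is_derive_unique _ _ _ H1 : Derive (fun x : R => mu x) u = _),
      (is_derive_unique _ _ _ H2 : Derive (fun x : R => delta x) u = _).
    unfold dKpar, sum_speed, diff_speed. field. lra.
Qed.

Lemma is_derive_Lpar (u : R) : 0 < u ->
  is_derive Lpar u ((sum_speed (mu u) (delta u) - diff_speed (mu u) (delta u))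
                    / (2 * u * delta u ^ 2)).
Proof.
  intros Hu. pose proof (delta_bounds u Hu) as HD. unfold Lpar.
  pose proof (is_derive_mu u Hu) as H1. pose proof (is_derive_delta u Hu) as H2.
  auto_derive.
  - repeat split; try lra; eexists; eassumption.
  - rewrite (is_derive_unique _ _ _ H1 : Derive (fun x : R => mu x) u = _),
      (is_derive_unique _ _ _ H2 : Derive (fun x : R => delta x) u = _).
    unfold sum_speed, diff_speed. field. lra.
Qed.

Definition dslope (u : R) : R :=
  4 * delta u * curvature_poly (mu u) (delta u)
  / (u * (sum_speed (mu u) (delta u) + diff_speed (mu u) (delta u)) ^ 2).

Lemma dslope_neg (u : R) : 0 < u -> dslope u < 0.
Proof.
  intros Hu. pose proof (speed_bounds u Hu). pose proof (delta_bounds u Hu) as HD.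
  assert (Hc : curvature_poly (mu u) (delta u) < 0).
  { apply curvature_poly_neg; [now apply mu_gt_2 | split; [lra | now apply delta_upper_bound]]. }
  apply Rmult_neg_pos; [nra |].
  apply Rinv_0_lt_compat, Rmult_lt_0_compat; [exact Hu | apply pow_lt; lra].
Qed.

Lemma is_derive_slope (u : R) : 0 < u ->
  is_derive (fun u => slope (mu u) (delta u)) u (dslope u).
Proof.
  intros Hu. pose proof (speed_bounds u Hu) as Hsp.
  pose proof (is_derive_mu u Hu) as H1. pose proof (is_derive_delta u Hu) as H2.
  unfold slope, sum_speed, diff_speed in *.
  auto_derive.
  - repeat split; try (eexists; eassumption). lra.
  - rewrite (is_derive_unique _ _ _ H1 : Derive (fun x : R => mu x) u = _),
      (is_derive_unique _ _ _ H2 : Derive (fun x : R => delta x) u = _).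
    unfold dslope, curvature_poly, sum_speed, diff_speed. field. lra.
Qed.

Lemma Kpar_incr (u v : R) : 0 < u -> u < v -> Kpar u < Kpar v.
Proof.
  intros Hu Huv.
  apply (incr_function Kpar 0 p_infty dKpar); simpl; try assumption; try exact I.
  - intros w Hw _. now apply is_derive_Kpar.
  - intros w Hw _. now apply dKpar_pos.
Qed.

Lemma Kpar_surj (K : R) : 2 < K -> exists u, 0 < u /\ Kpar u = K.
Proof.
  intros HK.
  (* [Kpar 0 = 2 < K]. At [u = 2 * K], positivity of [delta u] forces [mu u > u], hence
     [Kpar u > u / 2 = K]. *)
  destruct (IVT_interv (fun u => Kpar u - K) 0 (2 * K)) as [u [Hu E]].
  - intros v Hv. apply continuity_pt_filterlim.
    apply (continuous_minus Kpar (fun _ => K)); [| apply continuous_const].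
    unfold Kpar.
    assert (HD : delta v <> 0).
    { destruct (proj1 Hv) as [Hv0 | <-]; [pose proof (delta_bounds v Hv0); lra | rewrite delta_0; lra]. }
    apply (continuous_mult (fun u => mu u + mu u ^ 2 / delta u) (fun _ => / 2));
      [| apply continuous_const].
    apply (continuous_plus mu (fun u => mu u ^ 2 / delta u)); [apply continuous_mu |].
    apply (continuous_mult (fun u => mu u ^ 2) (fun u => / delta u)).
    + apply (continuous_comp mu (fun s => s ^ 2)); [apply continuous_mu | cont].
    + apply continuous_Rinv_comp; [apply continuous_delta | exact HD].
  - lra.
  - unfold Kpar. rewrite mu_0, delta_0. lra.
  - assert (Hv : 0 < 2 * K) by lra. pose proof (mu_gt_2 _ Hv) as Hs.
    pose proof (delta_bounds _ Hv) as HD.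
    assert (0 < mu (2 * K) ^ 2 / delta (2 * K)).
    { apply Rdiv_lt_0_compat; [apply pow_lt |]; lra. }
    assert (2 * K < mu (2 * K)) by (unfold delta in HD; nra).
    unfold Kpar. lra.
  - exists u. split; [| lra].
    destruct (proj1 Hu) as [H | <-]; [exact H |].
    unfold Kpar in E. rewrite mu_0, delta_0 in E. lra.
Qed.

(** * The parametrization describes exactly the bifurcation line *)

Lemma rstar_sqr_pos (K L : R) :
  L < 0 -> K + L > 2 -> 0 < 1 - 2 * K / (K ^ 2 - L ^ 2).
Proof.
  intros HL HKL. assert (HP : 2 * K < K ^ 2 - L ^ 2) by nra.
  enough (2 * K / (K ^ 2 - L ^ 2) < 1) by lra.
  apply (Rmult_lt_reg_r (K ^ 2 - L ^ 2)); [lra |].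
  unfold Rdiv. rewrite Rmult_assoc, Rinv_l; lra.
Qed.

Lemma on_bifurcation_line_par (u : R) : 0 < u -> on_bifurcation_line (Kpar u) (Lpar u).
Proof.
  intros Hu. pose proof (mu_gt_2 u Hu) as Hs. pose proof (delta_bounds u Hu) as HD.
  assert (Esum : Kpar u + Lpar u = mu u) by (unfold Kpar, Lpar; field; lra).
  (* With [s = K + L] and [d = K - L], [2 * K / (K ^ 2 - L ^ 2) = 1 / s + 1 / d = 1 / mu u + delta u
     / mu u ^ 2], and 1 minus this is [u ^ 2 / mu u ^ 2] by definition of [delta]. *)
  assert (Er : rstar (Kpar u) (Lpar u) = u / mu u).
  { unfold rstar.
    assert (0 < u / mu u) by (apply Rdiv_lt_0_compat; lra).
    replace (1 - _) with ((u / mu u) * (u / mu u)); [apply sqrt_square; lra |].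
    replace (Kpar u ^ 2 - Lpar u ^ 2) with (mu u ^ 3 / delta u)
      by (unfold Kpar, Lpar; field; lra).
    unfold Kpar. replace (u / mu u * (u / mu u)) with (u ^ 2 / mu u ^ 2) by (field; lra).
    replace (u ^ 2) with (mu u ^ 2 - mu u - delta u) by (unfold delta; ring).
    field. lra. }
  split; [| split].
  - enough (mu u < mu u ^ 2 / delta u) by (unfold Lpar; lra).
    apply (Rmult_lt_reg_r (delta u)); [lra |].
    unfold Rdiv. rewrite Rmult_assoc, Rinv_l by lra. nra.
  - lra.
  - rewrite Esum, Er. replace (mu u * (u / mu u)) with u by (field; lra).
    symmetry. apply V_eq.
Qed.

Definition argument (K L : R) : R := (K + L) * rstar K L.

(** The parameter of a point is the argument of [V] in its defining equation. Cancelling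
    [rstar K L > 0] in [rstar K L = u / mu u] gives [mu u = K + L]; the formula for [rstar K L ^ 2]
    then determines [delta u], hence [K - L]. *)
Lemma bifurcation_line_par_inv (K L : R) : on_bifurcation_line K L ->
  let u := argument K L in 0 < u /\ Kpar u = K /\ Lpar u = L.
Proof.
  intros [HL [HKL Hr]] u. pose proof (rstar_sqr_pos K L HL HKL) as Hp.
  assert (Hr0 : 0 < rstar K L) by (apply sqrt_lt_R0, Hp).
  assert (Hr2 : rstar K L ^ 2 = 1 - 2 * K / (K ^ 2 - L ^ 2)) by (apply pow2_sqrt; lra).
  assert (Hu : 0 < u) by (apply Rmult_lt_0_compat; lra).
  fold (argument K L) in Hr. fold u in Hr. rewrite V_eq in Hr.
  pose proof (mu_gt_2 u Hu) as Hs. pose proof (delta_bounds u Hu) as HD.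
  assert (Es : mu u = K + L).
  { assert (E : mu u * rstar K L = (K + L) * rstar K L).
    { rewrite Hr at 1. fold (argument K L). fold u. field. lra. }
    apply Rmult_eq_reg_r in E; lra. }
  assert (Ed : delta u = mu u ^ 2 / (K - L)).
  { unfold delta. rewrite Es. unfold u, argument.
    rewrite Rpow_mult_distr, Hr2. field. nra. }
  assert (Ed' : mu u ^ 2 / delta u = K - L) by (rewrite Ed; field; lra).
  split; [exact Hu |]. unfold Kpar, Lpar. rewrite Ed', Es. lra.
Qed.

(** * From the parameter [u] back to [L] as a function of [K] *)

(** Continuity of [g] at [x] is derived from monotonicity: if [t] lies between [f (g x - h)] and
    [f (g x + h)], then [g t] lies between [g x - h] and [g x + h]. *)
Lemma is_derive_right_inverse (f g : R -> R) (x df : R) :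
  (forall y z, 0 < y -> y < z -> f y < f z) ->
  locally x (fun t => 0 < g t /\ f (g t) = t) ->
  is_derive f (g x) df -> 0 < df -> is_derive g x (/ df).
Proof.
  intros Hinc Hloc Hf Hdf.
  destruct (locally_singleton _ _ Hloc) as [Hgx Hfgx].
  assert (Hcont : filterlim g (locally x) (locally (g x))).
  { intros P [e He].
    (* Besides fitting in the ball, [h] keeps [g x - h] positive, where [f] is known to be
       monotone. *)
    pose (h := Rmin (e / 2) (g x / 2)).
    assert (Hh : 0 < h /\ h < e /\ h <= g x / 2).
    { pose proof (cond_pos e). unfold h, Rmin. destruct Rle_dec; lra. }
    pose proof (Hinc (g x - h) (g x) ltac:(lra) ltac:(lra)) as Hlo.
    pose proof (Hinc (g x) (g x + h) ltac:(lra) ltac:(lra)) as Hhi.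
    rewrite Hfgx in Hlo, Hhi.
    assert (Hint : locally x (fun t => f (g x - h) < t < f (g x + h))).
    { apply (open_and (fun t => f (g x - h) < t) (fun t => t < f (g x + h)));
        [apply open_gt | apply open_lt | lra]. }
    change (locally x (fun t => P (g t))).
    generalize (filter_and _ _ Hloc Hint). apply filter_imp.
    intros t [[Hgt Hfgt] Ht]. apply He.
    assert (g x - h < g t).
    { apply Rnot_le_lt. intros [H | H].
      - pose proof (Hinc _ _ Hgt H). lra.
      - rewrite <- H in Ht. lra. }
    assert (g t < g x + h).
    { apply Rnot_le_lt. intros [H' | H'].
      - pose proof (Hinc (g x + h) (g t) ltac:(lra) H'). lra.
      - rewrite H' in Ht. lra. }
    unfold ball; simpl; unfold AbsRing_ball, abs, minus, plus, opp; simpl.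
    apply Rabs_lt_between. lra. }
  split; [apply is_linear_scal_l |].
  intros x' Hx' eps. apply (is_filter_lim_locally_unique (V := R_NormedModule)) in Hx'. subst x'.
  destruct Hf as [_ Hf]. specialize (Hf (g x) (fun P H => H)).
  (* For increments [a] of [g] and [b] of its argument, the bound [df / 2] gives
     [df / 2 * Rabs a <= Rabs b]; the other bound then turns an error relative to [a] into one
     relative to [b]. *)
  assert (He : 0 < Rmin (df / 2) (eps * (df * df) / 2)).
  { pose proof (cond_pos eps). apply Rmin_case; [lra |].
    apply Rdiv_lt_0_compat; [repeat apply Rmult_lt_0_compat |]; lra. }
  specialize (Hf (mkposreal _ He)). apply Hcont in Hf.
  unfold filtermap in Hf. generalize (filter_and _ _ Hloc Hf). apply filter_imp.
  intros t [[_ Hfgt] Ht].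
  unfold norm, minus, plus, opp, scal in *; simpl in *. unfold abs, mult in *; simpl in *.
  rewrite Hfgt, Hfgx in Ht.
  set (e := Rmin (df / 2) (eps * (df * df) / 2)) in *.
  assert (He1 : e <= df / 2) by apply Rmin_l.
  assert (He2 : e <= eps * (df * df) / 2) by apply Rmin_r.
  set (a := g t + - g x) in *. set (b := t + - x) in *.
  assert (Ha : df / 2 * Rabs a <= Rabs b).
  { assert (H : Rabs (a * df) <= Rabs b + Rabs (b + - (a * df))).
    { replace (a * df) with (b - (b + - (a * df))) at 1 by ring.
      eapply Rle_trans; [apply Rabs_triang |]. rewrite Rabs_Ropp. apply Rle_refl. }
    rewrite Rabs_mult, (Rabs_pos_eq df) in H by lra.
    pose proof (Rabs_pos a). nra. }
  replace (a + - (b * / df)) with (- (/ df * (b + - (a * df)))) by (field; lra).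
  rewrite Rabs_Ropp, Rabs_mult, (Rabs_pos_eq (/ df)) by (left; now apply Rinv_0_lt_compat).
  apply (Rmult_le_reg_l df); [exact Hdf |].
  rewrite <- Rmult_assoc, Rinv_r, Rmult_1_l by lra.
  eapply Rle_trans; [exact Ht |].
  pose proof (Rabs_pos a). pose proof (cond_pos eps).
  apply Rle_trans with (eps * (df * df) / 2 * Rabs a); [nra |].
  replace (eps * (df * df) / 2 * Rabs a) with (eps * df * (df / 2 * Rabs a)) by field.
  replace (df * (eps * Rabs b)) with (eps * df * Rabs b) by ring.
  apply Rmult_le_compat_l; [nra | exact Ha].
Qed.

Lemma locally_gt (a x : R) : a < x -> locally x (fun t => a < t).
Proof. intros H. now apply (open_gt a). Qed.

(** Existence is surjectivity of [Kpar] onto [K > 2]; uniqueness is its strict monotonicity, since a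
    point is determined by its parameter. *)
Lemma exists_unique_bifurcation_point (K : R) :
  2 < K -> exists! L : R, on_bifurcation_line K L.
Proof.
  intros HK. destruct (Kpar_surj K HK) as [u [Hu <-]].
  exists (Lpar u). split; [now apply on_bifurcation_line_par |].
  intros L HL. destruct (bifurcation_line_par_inv _ _ HL) as [Hv [EK EL]].
  rewrite <- EL. f_equal.
  destruct (Rtotal_order u (argument (Kpar u) L)) as [H | [H | H]]; [| exact H |].
  - pose proof (Kpar_incr _ _ Hu H). lra.
  - pose proof (Kpar_incr _ _ Hv H). lra.
Qed.

(** Along any branch the parameter is a right inverse of [Kpar], so differentiability follows from
    that of [Kpar] alone. *)
Lemma is_derive_branch_argument (Lstar : R -> R) :
  (forall K, 2 < K -> on_bifurcation_line K (Lstar K)) ->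
  forall K, 2 < K -> let u := argument K (Lstar K) in
  is_derive (fun K => argument K (Lstar K)) K
    (/ dKpar u).
Proof.
  intros HL K HK u.
  assert (Hu : 0 < u) by apply (bifurcation_line_par_inv _ _ (HL K HK)).
  apply (is_derive_right_inverse Kpar).
  - apply Kpar_incr.
  - apply filter_imp with (2 := locally_gt 2 K HK). intros t Ht.
    destruct (bifurcation_line_par_inv _ _ (HL t Ht)) as [H1 [H2 _]]. now split.
  - now apply is_derive_Kpar.
  - now apply dKpar_pos.
Qed.

(** Near [K], [Lstar] is [Lpar] composed with the parameter; the common factor [2 * u * delta u ^ 2]
    cancels in the chain rule. *)
Lemma is_derive_branch (Lstar : R -> R) :
  (forall K, 2 < K -> on_bifurcation_line K (Lstar K)) ->
  forall K, 2 < K -> let u := argument K (Lstar K) in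
  is_derive Lstar K (slope (mu u) (delta u)).
Proof.
  intros HL K HK u.
  assert (Hu : 0 < u) by apply (bifurcation_line_par_inv _ _ (HL K HK)).
  apply is_derive_ext_loc with (fun K => Lpar (argument K (Lstar K))).
  { apply filter_imp with (2 := locally_gt 2 K HK). intros t Ht.
    apply (bifurcation_line_par_inv _ _ (HL t Ht)). }
  evar_last.
  - apply (is_derive_comp Lpar (fun K => argument K (Lstar K))).
    + apply is_derive_Lpar, Hu.
    + apply is_derive_branch_argument; assumption.
  - fold u. pose proof (speed_bounds u Hu). pose proof (delta_bounds u Hu).
    unfold dKpar, slope, scal; simpl; unfold mult; simpl. field. lra.
Qed.

(** The slope decreases in [u], and [u] increases with [K]. *)
Lemma is_derive_branch_slope (Lstar : R -> R) :
  (forall K, 2 < K -> on_bifurcation_line K (Lstar K)) ->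
  forall K, 2 < K -> exists l, is_derive (Derive Lstar) K l /\ l < 0.
Proof.
  intros HL K HK. pose (u := argument K (Lstar K)).
  assert (Hu : 0 < u) by apply (bifurcation_line_par_inv _ _ (HL K HK)).
  eexists. split.
  - apply is_derive_ext_loc with
      (fun K => slope (mu (argument K (Lstar K))) (delta (argument K (Lstar K)))).
    { apply filter_imp with (2 := locally_gt 2 K HK). intros t Ht.
      symmetry. apply is_derive_unique. now apply is_derive_branch. }
    apply (is_derive_comp (fun u => slope (mu u) (delta u)) (fun K => argument K (Lstar K))).
    + apply is_derive_slope, Hu.
    + apply is_derive_branch_argument; assumption.
  - unfold scal; simpl; unfold mult; simpl. fold u. apply Rmult_pos_neg.
    + now apply Rinv_0_lt_compat, dKpar_pos.
    + now apply dslope_neg.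
Qed.

Theorem lemma4p6 :
  (forall K : R, 2 < K -> exists! L : R, on_bifurcation_line K L) /\
  (forall Lstar : R -> R,
    (forall K : R, 2 < K -> on_bifurcation_line K (Lstar K)) ->
    forall K : R, 2 < K ->
      (ex_derive Lstar K /\ Derive Lstar K < 0) /\
      (ex_derive_n Lstar 2 K /\ Derive_n Lstar 2 K < 0)).
Proof.
  split; [exact exists_unique_bifurcation_point |].
  intros Lstar HL K HK.
  destruct (bifurcation_line_par_inv _ _ (HL K HK)) as [Hu _].
  pose proof (is_derive_branch Lstar HL K HK) as H1.
  set (u := argument K (Lstar K)) in *. cbv zeta in H1.
  destruct (is_derive_branch_slope Lstar HL K HK) as [l [H2 Hl]].
  split; split.
  - eexists. exact H1.
  - rewrite (is_derive_unique _ _ _ H1).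
    (* The slope has numerator [sum_speed - diff_speed < 0] and a positive denominator. *)
    pose proof (speed_bounds u Hu).
    unfold slope. apply Rmult_neg_pos; [lra |]. apply Rinv_0_lt_compat. lra.
  - eexists. exact H2.
  - change (Derive (Derive Lstar) K < 0). now rewrite (is_derive_unique _ _ _ H2).
Qed.
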